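(* Let $n\ge1$, let $\mathbf{D}=(D_1,\dots,D_k)$ be a bosonic multiline queue of type $(\alpha,n)$, where $\alpha=(\alpha_1,\dots,\alpha_k)$ is a weak composition, and let $\mathbf{b}=D_1\otimes\cdots\otimes D_k\in\widetilde{\mathcal{B}}^{\alpha}=\widetilde{\mathcal{B}}^{\alpha_1}\otimes\cdots\otimes\widetilde{\mathcal{B}}^{\alpha_k}$ be the corresponding element. Then $$\widetilde{\Phi}(\mathbf{D})=\pi(\mathbf{b}).$$
   Context: Fix $n\ge1$, $[n]=\{1,\dots,n\}$; sites are considered cyclically (in $\mathbb{Z}/n\mathbb{Z}$). $\mathcal{M}(n)$ is the set of finite multisets with entries in $[n]$. A bosonic multiline queue of type $(\alpha,n)$, $\alpha=(\alpha_1,\dots,\alpha_k)$ a sequence of nonnegative integers, is a tuple $\mathbf{D}=(D_1,\dots,D_k)$ with $D_j\in\mathcal{M}(n)$, $|D_j|=\alpha_j$ (row 1 is the bottom row; multiplicity of $j$ in $D_i$ = number of particles at site $j$ of row $i$). $\widetilde{\mathcal{W}}$ is the set of words $(A_1,\dots,A_n)$ of finite multisets of positive integers. Pairing. For $A,B\in\mathcal{M}(n)$ ($A$ the lower row, $B$ the upper row), $\mathrm{cpair_b}(A,B)$ is: for $j=1,\dots,n$ in order, write '')'' once for each instance of $j$ in $B$ and then ''('' once for each instance of $j$ in $A$; view the bracket word on a circle and recursively match each ''('' with a '')'' following it cyclically when there are no unmatched brackets between them. A particle of $A$ or $B$ is paired (unpaired) if its bracket is matched (unmatched); particles are counted with multiplicity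 at each site. Crystals and R matrix. $\widetilde{\mathcal{B}}^s$ is the set of elements of $\mathcal{M}(n)$ of size $s$ (single-row Kirillov–Reshetikhin crystal of type $A_{n-1}^{(1)}$); a tensor product is, as a set, a Cartesian product. The combinatorial R matrix $\mathcal{R}:\widetilde{\mathcal{B}}^{s}\otimes\widetilde{\mathcal{B}}^{s'}\to\widetilde{\mathcal{B}}^{s'}\otimes\widetilde{\mathcal{B}}^{s}$ is given by the Nakayashiki–Yamada rule: $\mathcal{R}(b\otimes c)$ is obtained from $b\otimes c$ by moving all particles unpaired in $\mathrm{cpair_b}(b,c)$ from the first factor to the second and from the second factor to the first (keeping their sites). $\mathcal{R}_i$ applies $\mathcal{R}$ to factors $i,i+1$, and $\mathcal{R}_{[a,b]}=\mathcal{R}_a\circ\mathcal{R}_{a+1}\circ\cdots\circ\mathcal{R}_b$ (applied right to left; identity if $b<a$). Projection $\pi$. Let $\pi_i(\mathbf{b})\in\mathcal{M}(n)$ be the first tensor factor of $\mathcal{R}_{[1,i-1]}(\mathbf{b})$, $1\le i\le k$. Then $\pi(\mathbf{b})=\pi_1(\mathbf{b})+\cdots+\pi_k(\mathbf{b})\in\widetilde{\mathcal{W}}$, where the sum means: the $j$-th letter of $\pi(\mathbf{b})$ is the multiset of positive integers such that, for every $m\ge1$, the number of its elements that are $\ge m$ equals the $m$-th largest among the multiplicities of $j$ in $\pi_1(\mathbf{b}),\dots,\pi_k(\mathbf{b})$ (and $0$ for $m>k$). Operators $D^{(\ell)}$. For $D\in\mathcal{M}(n)$, $\ell\ge1$ and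 $\widetilde{\mathbf{u}}=(\widetilde u_1,\dots,\widetilde u_n)\in\widetilde{\mathcal{W}}$ with $\ell<\min\bigcup_i\widetilde u_i$, define $D^{(\ell)}(\widetilde{\mathbf{u}})=(Y_1,\dots,Y_n)\in\widetilde{\mathcal{W}}$ as follows. Initialize all $Y_j=\emptyset$. Let $a=\min\bigcup_i\widetilde u_i$, $K=\max\bigcup_i\widetilde u_i$, and let $\widetilde u^{(r)}\in\mathcal{M}(n)$ be the multiset in which $j$ has multiplicity equal to the number of elements $\ge r$ of $\widetilde u_j$. Pairing phase: let $s$ be the maximal $r\in\{a,\dots,K\}$ with $|\widetilde u^{(r)}|\ge|D|$, if it exists, and $s=a$ otherwise. For $r=K,K-1,\dots,s$: for each newly paired particle of $D$ at site $j$, add an element $r$ to $Y_j$ (the number of newly paired particles at site $j$ is the number of particles of $D$ at $j$ paired in $\mathrm{cpair_b}(D,\widetilde u^{(r)})$ minus the number paired in $\mathrm{cpair_b}(D,\widetilde u^{(r+1)})$). Then for each particle of $D$ unpaired in $\mathrm{cpair_b}(D,\widetilde u^{(s)})$, at site $j$ say, add an element $\ell$ to $Y_j$. Collapsing phase: for $r=s,s-1,\dots,a$: for each newly unpaired particle of $\widetilde u^{(r)}$ at site $j$, add an element $r-1$ to $Y_j$ (the number of newly unpaired particles at $j$ is the number of particles of $\widetilde u^{(r)}$ at $j$ unpaired in $\mathrm{cpair_b}(D,\widetilde u^{(r)})$ minus the number of particles of $\widetilde u^{(r+1)}$ at $j$ unpaired in $\mathrm{cpair_b}(D,\widetilde u^{(r+1)})$).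 For the empty word $\widetilde{\mathbf{w}}_0=(\emptyset,\dots,\emptyset)$, $D^{(\ell)}(\widetilde{\mathbf{w}}_0)$ has at site $j$ the multiset consisting of $\ell$ repeated as many times as $j$ occurs in $D$. Projection: $\widetilde\Phi(\mathbf{D})=D_1^{(1)}\bigl(D_2^{(2)}(\cdots D_k^{(k)}(\widetilde{\mathbf{w}}_0)\cdots)\bigr)$. *)

(* Defs.v *)
From mathcomp Require Import all_boot finmap multiset.

Set Implicit Arguments.
Unset Strict Implicit.
Unset Printing Implicit Defensive.

Open Scope mset_scope.
Open Scope nat_scope.

(* M(n): site j of {1, ..., n} is the ordinal of value j - 1. *)
Notation multirow n := {mset 'I_n}.

(* The letters of a word are multisets of positive integers; only positive
   entries are ever inserted below. *)
Definition word (n : nat) := {ffun 'I_n -> {mset nat}}.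

Definition empty_word (n : nat) : word n := [ffun => mset0].

(* Entry 0 of the tuple is the bottom row D_1.  As a set, the tensor product
   of the crystals B^(alpha_j) is a Cartesian product, so the same tuple is
   also the element D_1 (x) ... (x) D_k. *)
Definition is_bmlq (k n : nat) (alpha : k.-tuple nat) (D : k.-tuple (multirow n)) :=
  forall i : 'I_k, size (tnth D i) = tnth alpha i.

Section Pairing.
Variable n : nat.
Implicit Types (A B D : multirow n) (w : seq (bool * 'I_n)) (u : word n).

(* (true, j) is the bracket "(" of a particle of the lower row A at site j,
   (false, j) the bracket ")" of a particle of the upper row B at site j. *)
Definition bracket_word A B : seq (bool * 'I_n) :=
  flatten [seq nseq (B j) (false, j) ++ nseq (A j) (true, j) | j <- enum 'I_n].

Definition starts_matched w : bool :=
  if w is (true, _) :: (false, _) :: _ then true else false.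

(* A seq stands for a circular word of still unmatched brackets, up to
   rotation.  One step looks for a "(" that is cyclically followed by a ")",
   so that no unmatched bracket lies between them, and removes both. *)
Definition match_step w : seq (bool * 'I_n) :=
  let p := find (fun p => starts_matched (rot p w)) (iota 0 (size w)) in
  if p < size w then drop 2 (rot p w) else w.

Definition unmatched A B : seq (bool * 'I_n) :=
  let w := bracket_word A B in iter (size w) match_step w.

Definition unpaired_lower A B : multirow n :=
  seq_mset [seq x.2 | x <- unmatched A B & x.1].

Definition unpaired_upper A B : multirow n :=
  seq_mset [seq x.2 | x <- unmatched A B & ~~ x.1].

Definition paired_lower A B : multirow n := A `\` unpaired_lower A B.
Definition paired_upper A B : multirow n := B `\` unpaired_upper A B.

Definition comb_R (bc : multirow n * multirow n) : multirow n * multirow n :=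
  let: (b, c) := bc in
  (paired_lower b c `+` unpaired_upper b c,
   paired_upper b c `+` unpaired_lower b c).

(* R_i, with i counted from 1; used for 1 <= i < size b only. *)
Definition R_at (i : nat) (b : seq (multirow n)) : seq (multirow n) :=
  let: (x, y) := comb_R (nth mset0 b i.-1, nth mset0 b i) in
  set_nth mset0 (set_nth mset0 b i.-1 x) i y.

(* R_p o R_(p+1) o ... o R_q, the identity when q < p. *)
Definition R_range (p q : nat) (b : seq (multirow n)) : seq (multirow n) :=
  foldr R_at b (index_iota p q.+1).

Definition pi_factor (b : seq (multirow n)) (i : nat) : multirow n :=
  nth mset0 (R_range 1 i.-1 b) 0.

End Pairing.

Definition mth_largest (m : nat) (s : seq nat) : nat :=
  nth 0 (sort geq s) m.-1.

(* The number of elements >= m has to be mth_largest m s, hence the number of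
   elements equal to m is a difference of two consecutive values. *)
Definition letter_of (s : seq nat) : {mset nat} :=
  \big[msetD/mset0]_(1 <= m < (size s).+1)
     msetn (mth_largest m s - mth_largest m.+1 s) m.

Definition word_sum (n : nat) (bs : seq (multirow n)) : word n :=
  [ffun j => letter_of [seq c j | c : multirow n <- bs]].

Definition proj_pi (n : nat) (b : seq (multirow n)) : word n :=
  word_sum [seq pi_factor b i | i <- iota 1 (size b)].

Lemma count_msetD (P : pred nat) (A B : {mset nat}) :
  count P (A `+` B) = count P A + count P B.
Proof.
have /permP -> : perm_eq (A `+` B) (A ++ B); last by rewrite count_cat.
by apply/allP => x _ /=; rewrite count_cat !count_mem_mset msetE2.
Qed.

Lemma mth_largest_anti (s : seq nat) (m : nat) :
  0 < m -> mth_largest m.+1 s <= mth_largest m s.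
Proof.
case: m => // m _; rewrite /mth_largest /=.
have srt : sorted geq (sort geq s) by apply: sort_sorted => x y; exact: leq_total.
have [lt|ge] := ltnP m.+1 (size (sort geq s)); last by rewrite nth_default.
by have /sortedP/(_ m lt) := srt; apply.
Qed.

Lemma sum_mth_largest (s : seq nat) (p q : nat) : 0 < p -> p <= q ->
  (\sum_(p <= r < q) (mth_largest r s - mth_largest r.+1 s))
    + mth_largest q s = mth_largest p s.
Proof.
move=> p_gt0; elim: q => [|q IH]; first by rewrite leqNgt p_gt0.
rewrite leq_eqVlt => /orP[/eqP <-|lt]; first by rewrite big_geq.
rewrite big_nat_recr //= -addnA subnK ?IH //.
by apply: mth_largest_anti; apply: leq_trans p_gt0 lt.
Qed.

Lemma count_letter_of (s : seq nat) (m : nat) :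
  0 < m -> count (leq m) (letter_of s) = mth_largest m s.
Proof.
move=> m_gt0.
have big0 r : size s < r -> mth_largest r s = 0.
  by case: r => // r lt; rewrite /mth_largest nth_default // size_sort.
have -> : count (leq m) (letter_of s) = \sum_(1 <= r < (size s).+1)
    (if m <= r then mth_largest r s - mth_largest r.+1 s else 0).
  rewrite /letter_of.
  apply: (big_rec2 (fun (A : {mset nat}) c => count (leq m) A = c)).
    by rewrite enum_mset0.
  move=> r c A _ <-; rewrite count_msetD enum_msetn count_nseq.
  by case: leq; rewrite ?mul1n ?mul0n.
have [gt|le] := ltnP (size s).+1 m.
  rewrite big0; last exact: ltn_trans gt.
  rewrite big_nat_cond big1 // => r /andP[/andP[_ rs] _].
  by rewrite leqNgt (ltn_trans rs gt).
rewrite (big_cat_nat m_gt0 le) /= big_nat_cond big1 => [|r]; last first.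
  by case/andP=> /andP[_ rm] _; rewrite leqNgt rm.
rewrite add0n -[RHS](sum_mth_largest s m_gt0 le) [mth_largest _.+1 s]big0 // addn0.
by apply: eq_big_nat => r /andP[-> _].
Qed.

Section Operators.
Variable n : nat.
Implicit Types (D : multirow n) (u : word n).

Definition level u (r : nat) : multirow n :=
  seq_mset (flatten [seq nseq (count (leq r) (u j)) j | j <- enum 'I_n]).

Definition max_word u : nat := \max_(j < n) \max_(x <- u j) x.

(* The seed max_word u is an upper bound of the entries, so this is their
   minimum as soon as u has at least one entry. *)
Definition min_word u : nat :=
  \big[minn/max_word u]_(j < n) \big[minn/max_word u]_(x <- u j) x.

(* The seed is the value taken when no r qualifies; otherwise the maximum of
   the qualifying r, all at least a, is not affected by it. *)
Definition last_paired_level D u : nat :=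
  let a := min_word u in
  \big[maxn/a]_(a <= r < (max_word u).+1 | size D <= size (level u r)) r.

(* level u r contains level u r.+1, so the paired particles of D at level r.+1
   are among those at level r, and the unpaired particles of level u r.+1 are
   among those of level u r: the truncated subtractions are exact. *)
Definition newly_paired D u (r : nat) (j : 'I_n) : nat :=
  paired_lower D (level u r) j - paired_lower D (level u r.+1) j.

Definition newly_unpaired D u (r : nat) (j : 'I_n) : nat :=
  unpaired_upper D (level u r) j - unpaired_upper D (level u r.+1) j.

(* Meaningful when l >= 1 and all entries of u are greater than l. *)
Definition mlq_op (l : nat) D u : word n :=
  if u == empty_word n then [ffun j => msetn (D j) l] else
  let a := min_word u in
  let K := max_word u in
  let s := last_paired_level D u in
  [ffun j =>
     \big[msetD/mset0]_(s <= r < K.+1) msetn (newly_paired D u r j) r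
     `+` msetn (unpaired_lower D (level u s) j) l
     `+` \big[msetD/mset0]_(a <= r < s.+1) msetn (newly_unpaired D u r j) r.-1].

Definition Phi (D : seq (multirow n)) : word n :=
  foldr (fun i w => mlq_op i (nth mset0 D i.-1) w) (empty_word n)
        (iota 1 (size D)).

End Operators.

(* Main.v *)
Require Import Defs.
From mathcomp Require Import all_boot finmap multiset.
From mathcomp Require Import zify.

Set Implicit Arguments.
Unset Strict Implicit.
Unset Printing Implicit Defensive.

(** Write F(b, c) for the first factor of R(b (x) c), that is, the paired
    particles of b together with the unpaired particles of c ([R_first]).
    Both sides of the identity are built one row at a time from the top.

    On the crystal side, the factors of b_1 (x) ... (x) b_k are b_1 itself and
    F(b_1, c) for c running over the factors of b_2 (x) ... (x) b_k
    ([pi_factors_cons]).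

    On the queue side, let u be the word of the rows above, with levels
    u^(r).  The levels of D^(l)(u) turn out to be the F(D, u^(r)) with D itself
    inserted at the level s where the sizes of the u^(r) drop below the size of
    D ([mlq_op_levels]): the pairing phase produces the F(D, u^(r)) with r > s,
    which lie inside D because nothing of u^(r) is unpaired; the collapsing
    phase produces, one level lower, those with r <= s, which contain D because
    all of D is paired.  The counts of newly paired and newly unpaired
    particles telescope.

    So the levels of the word are always a reordering of the factors of the
    crystal element ([queue_word_levels]).  Levels decrease, hence at each site
    this reordering is the decreasing one, which is how the projection is
    defined.

    Telescoping needs the differences to be exact, i.e. that enlarging the
    upper row can only turn unpaired lower particles into paired ones and add
    unpaired upper ones ([unpaired_lower_anti], [unpaired_upper_mono]).  This
    is proved by replacing the matching on a circle by a counter running once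
    along the word, started from a value to which it returns. *)

(** * Circular matching as a counter with a stationary initial value *)

Section Automaton.
Variable T : eqType.
Implicit Types (o : bool) (w s : seq (bool * T)) (x y : nat) (j : T).

(** The parameter [o] selects which of the two brackets opens: [true] for a word
    read from left to right, [false] for a word read backwards. *)
Definition brackets o w := count (fun a : bool * T => a.1 == o) w.

(** Number of open brackets waiting for a partner after reading [w], when [x]
    of them were waiting at the start. *)
Fixpoint pending o x w : nat :=
  if w is a :: w' then pending o (if a.1 == o then x.+1 else x.-1) w' else x.

(** Closing brackets labelled [j] that found no waiting partner. *)
Fixpoint surplus o j x w : nat :=
  if w is a :: w' then
    if a.1 == o then surplus o j x.+1 w'
    else ((x == 0) && (a.2 == j)) + surplus o j x.-1 w'
  else 0.

Lemma pending_cat o x w s : pending o x (w ++ s) = pending o (pending o x w) s.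
Proof. by elim: w x => //= a w IH x. Qed.

Lemma surplus_cat o j x w s :
  surplus o j x (w ++ s) = surplus o j x w + surplus o j (pending o x w) s.
Proof. by elim: w x => //= a w IH x; case: eqP => _; rewrite IH // addnA. Qed.

(** On a circle the brackets open at the start are those left open by the
    previous turn, so the right initial value is one that a full turn
    reproduces.  Stating this as a relation with [c], rather than choosing
    the value, makes it stable under rotations and cancellations. *)
Definition circular_surplus o w (c : T -> nat) :=
  exists2 x, pending o x w = x & forall j, surplus o j x w = c j.

(** After rotation, the value reached at the new origin is stationary. *)
Lemma circular_surplus_rot o p w c :
  circular_surplus o w c -> circular_surplus o (rot p w) c.
Proof.
rewrite -{1}(cat_take_drop p w) /rot; set s1 := take _ _; set s2 := drop _ _.
case=> x; rewrite pending_cat => px cx; exists (pending o x s1).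
  by rewrite pending_cat px.
by move=> j; rewrite surplus_cat px -cx surplus_cat addnC.
Qed.

Lemma circular_surplus_cancel o i j s c :
  circular_surplus o ((o, i) :: (~~ o, j) :: s) c -> circular_surplus o s c.
Proof.
case=> x /=; rewrite eqxx; have -> : (~~ o == o) = false by case: (o).
by move=> px cx; exists x.
Qed.

(** Among closing brackets only, a positive stationary value is possible only if
    the word is empty, so every bracket is counted. *)
Lemma circular_surplus_end o w c :
  all (fun a => a.1 == ~~ o) w -> circular_surplus o w c ->
  forall j, c j = count_mem (~~ o, j) w.
Proof.
move=> wP [x px cx] j; rewrite -cx {cx}.
have pE : pending o x w = x - size w.
  elim: w x wP {px} => [|a w IH] x /=; first by rewrite subn0.
  by case/andP=> /eqP-> /IH->; case: o {IH} => /=; lia.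
have [->|x_gt0] := posnP x; last first.
  by have -> : w = [::] by apply: size0nil; lia.
elim: w wP {px pE} => //= -[b i] w IH /andP[/= /eqP-> /IH ->].
by rewrite xpair_eqE eqxx /=; case: o {IH} => /=.
Qed.

(** This relation is compatible with concatenation and holds when closing
    brackets are inserted or opening brackets deleted, hence it compares the
    bracket words of two rows site by site. *)
Definition dominated o w w' := forall x x', x' <= x ->
  pending o x' w' <= pending o x w /\ forall j, surplus o j x w <= surplus o j x' w'.

Lemma dominated_refl o w : dominated o w w.
Proof.
elim: w => [|a w IH] x x' le /=; first by split.
case: eqP => _; first by apply: IH.
have [|pw sw] := IH x.-1 x'.-1; first by lia.
by split=> // j; apply: leq_add (sw j); case: (a.2 == j); lia.
Qed.

Lemma dominated_cat o w1 w1' w2 w2' :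
  dominated o w1 w1' -> dominated o w2 w2' ->
  dominated o (w1 ++ w2) (w1' ++ w2').
Proof.
move=> d1 d2 x x' le; rewrite !pending_cat.
have [p1 s1] := d1 _ _ le; have [p2 s2] := d2 _ _ p1.
by split=> // j; rewrite !surplus_cat leq_add.
Qed.

Lemma dominated_closers o m j : dominated o [::] (nseq m (~~ o, j)).
Proof.
move=> x x' le; split=> //=; elim: m x' le => //= m IH x' le.
by have -> : (~~ o == o) = false by [case: (o)]; apply: IH; lia.
Qed.

Lemma dominated_openers o m j : dominated o (nseq m (o, j)) [::].
Proof.
move=> x x' le; have H : x' <= pending o x (nseq m (o, j)) /\ forall k,
   surplus o k x (nseq m (o, j)) = 0; last by case: H => ? H; split=> // k; rewrite H.
by elim: m x le => //= m IH x le; rewrite eqxx; apply: IH; lia.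
Qed.

Lemma pending_large o x w : brackets (~~ o) w <= x ->
  pending o x w + brackets (~~ o) w = x + brackets o w.
Proof.
rewrite /brackets; elim: w x => [|[b i] w IH] x //=.
have -> : (b == ~~ o) = (b != o) by case: (b); case: (o).
case: (b == o) => /= le.
  by rewrite IH; lia.
have le' : count (fun a : bool * T => a.1 == ~~ o) w <= x.-1 by lia.
by have := IH _ le'; lia.
Qed.

(** [pending] is monotone in the initial value, so iterating it from a value
    that it does not increase descends to a fixed point. *)
Lemma pending_descent o w x : pending o x w <= x ->
  exists2 y, y <= x & pending o y w = y.
Proof.
elim/ltn_ind: x => x IH; rewrite leq_eqVlt => /orP[/eqP e|lt]; first by exists x.
have [le _] := dominated_refl o w (ltnW lt).
by have [y ley e] := IH _ lt le; exists y => //; apply: leq_trans ley (ltnW lt).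
Qed.

Lemma circular_surplus_ex o w :
  brackets o w <= brackets (~~ o) w ->
  exists2 x, pending o x w = x & circular_surplus o w (fun j => surplus o j x w).
Proof.
move=> le; have := pending_large (leqnn (brackets (~~ o) w)).
move=> e; have [|x _ px] := @pending_descent o w (brackets (~~ o) w).
  by lia.
by exists x => //; exists x.
Qed.

(** A stationary value of the dominated word is not increased by [w'], hence
    [w'] has a stationary value below it, and from there the outputs compare.
    The hypotheses on [c] and [c'] say that they do not depend on
    the stationary values used; existence for [w] comes from the count of its
    brackets. *)
Lemma dominated_surplus o w w' c c' : dominated o w w' ->
  (forall d, circular_surplus o w d -> d =1 c) ->
  (forall d, circular_surplus o w' d -> d =1 c') ->
  brackets o w <= brackets (~~ o) w ->
  forall j, c j <= c' j.
Proof.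
move=> dom cP cP' /circular_surplus_ex[x px /cP cx] j.
have [] := dom x x (leqnn _); rewrite px => le _.
have [x' lex' px'] := pending_descent le.
have [_ /(_ j) sle] := dom _ _ lex'.
by rewrite -cx (leq_trans sle) // -(cP' (fun j => surplus o j x' w')) //; exists x'.
Qed.

End Automaton.

(** * Unpaired particles of two rows *)

Section Matching.
Variable n : nat.
Implicit Types (A B D : multirow n) (w s : seq (bool * 'I_n)).

(** Read backwards, a matched pair is again an opening bracket followed by a
    closing one, with the two roles exchanged.  Thus one automaton counts the
    unmatched brackets of both kinds. *)
Definition oriented o w := if o then w else rev w.

Definition irreducible w := forall p, p < size w -> ~~ starts_matched (rot p w).

Variant match_step_spec w : seq (bool * 'I_n) -> Prop :=
| MatchStepEnd of irreducible w : match_step_spec w w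
| MatchStep p i j s of rot p w = (true, i) :: (false, j) :: s :
    match_step_spec w s.

Lemma match_stepP w : match_step_spec w (match_step w).
Proof.
rewrite /match_step; set f := fun p => _.
case: ifP => [lt|/negbT]; last first.
  rewrite -{2}(size_iota 0 (size w)) -has_find => /hasPn nomatch.
  by left=> p lt; apply: nomatch; rewrite mem_iota.
have : f (nth 0 (iota 0 (size w)) (find f (iota 0 (size w)))).
  by apply: nth_find; rewrite has_find size_iota.
rewrite nth_iota // add0n; set p := find _ _; rewrite /f.
case E: (rot p w) => [|[[] i] [|[[] j] s]] //= _.
rewrite drop0; exact: MatchStep E.
Qed.

Lemma match_step_surplus o w c : circular_surplus o (oriented o w) c ->
  circular_surplus o (oriented o (match_step w)) c.
Proof.
case: match_stepP => // p i j s E; case: o => /= cw.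
  by apply: (@circular_surplus_cancel _ true i j); rewrite -E; apply: circular_surplus_rot.
apply: (@circular_surplus_cancel _ false j i).
have : circular_surplus false (rot (size s) (rev (rot p w))) c.
  by apply: circular_surplus_rot; rewrite rev_rot; apply: circular_surplus_rot.
rewrite E !rev_cons -(size_rev s) -!cats1 -catA rot_size_cat. done.
Qed.

Lemma match_step_count w P : count P (match_step w) <= count P w.
Proof.
case: match_stepP => // p i j s E.
have <- : count P (rot p w) = count P w by apply/permP; rewrite perm_rot.
by rewrite E /=; lia.
Qed.

Lemma match_step_balance w :
  brackets true (match_step w) + brackets false w =
  brackets false (match_step w) + brackets true w.
Proof.
case: match_stepP => [_|p i j s E]; first exact: addnC.
have H P : count P (rot p w) = count P w by apply/permP; rewrite perm_rot.
by rewrite /brackets -!H E /=; lia.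
Qed.

(** If both kinds occur, start the circle at an opening bracket: the first
    closing bracket after it is preceded by an opening one. *)
Lemma irreducible_uniform w : irreducible w ->
  all (fun a => a.1) w || all (fun a => ~~ a.1) w.
Proof.
move=> irr; apply/negPn/negP; rewrite negb_or -!has_predC => /andP[hasF hasT].
have /hasP[[[] i] //= iw _] : has (fun a => a.1) w.
  by rewrite (eq_has (a2 := predC (fun a => ~~ a.1))) // => a /=; rewrite negbK.
pose p := index (true, i) w.
have lep : p <= size w by rewrite index_size.
have rp : rot p w = (true, i) :: drop p.+1 w ++ take p w.
  by rewrite /rot (drop_nth (true, i)) ?index_mem // nth_index.
set u := drop _ _ ++ _ in rp.
have hasu : has (fun a => ~~ a.1) u.
  suff : has (fun a => ~~ a.1) (rot p w) by rewrite rp.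
  by rewrite has_rot.
pose q := find (fun a => ~~ a.1) u.
have qP : q < size u by rewrite -has_find.
have ltq : q < size w by rewrite -(size_rot p) rp /=; lia.
have sm : starts_matched (rot q (rot p w)).
  rewrite rp /rot (drop_nth (true, i)) /=; last by lia.
  rewrite (drop_nth (true, i)) // /=.
  have : (nth (true, i) ((true, i) :: u) q).1.
    case Eq: q => [|r] //=; apply/negPn/negP => H.
    by have := @before_find _ (true, i) (fun a => ~~ a.1) u r; rewrite H -/q Eq ltnSn => /(_ isT).
  have := nth_find (true, i) hasu; rewrite -/q.
  by case: (nth _ u q) => -[] k //= _; case: (nth _ _ q) => -[].
move: sm; rewrite rot_add_mod ?(ltnW ltq) //.
have nsm r : r < size w -> starts_matched (rot r w) = false by move/irr/negbTE.
case: ifP => le; last by rewrite nsm //; lia.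
have [->|ne] := eqVneq (q + p) (size w); last by rewrite nsm //; lia.
by rewrite rot_size -(rot0 w) nsm //; lia.
Qed.

Lemma iter_match_step_irreducible m w :
  size w <= m -> irreducible (iter m (@match_step n) w).
Proof.
elim: m w => [|m IH] w lew; first by move=> p; case: w lew.
rewrite iterSr; case: match_stepP => [irr|p i j s E].
  suff -> : iter m (@match_step n) w = w by [].
  elim: m {IH lew} => //= m ->; case: match_stepP => // p i j s E.
  have lep : p < size w.
    rewrite ltnNge; apply/negP => lep; have := irr 0.
    by rewrite rot0; rewrite rot_oversize // in E; rewrite E /= => /(_ isT).
  by have := irr p lep; rewrite E.
by apply: IH; have := congr1 size E; rewrite size_rot /=; lia.
Qed.

Lemma unmatched_uniform A B :
  all (fun a => a.1) (unmatched A B) || all (fun a => ~~ a.1) (unmatched A B).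
Proof. exact/irreducible_uniform/iter_match_step_irreducible. Qed.

Lemma unmatched_surplus o A B c :
  circular_surplus o (oriented o (bracket_word A B)) c ->
  circular_surplus o (oriented o (unmatched A B)) c.
Proof.
by move=> H; rewrite /unmatched; elim: (size _) => //= m; apply: match_step_surplus.
Qed.

Lemma unmatched_balance A B :
  brackets true (unmatched A B) + brackets false (bracket_word A B) =
  brackets false (unmatched A B) + brackets true (bracket_word A B).
Proof.
rewrite /unmatched; elim: (size _) => [|m IH] /=; first exact: addnC.
by have := match_step_balance (iter m (@match_step n) (bracket_word A B)); lia.
Qed.

Lemma unmatched_count A B P : count P (unmatched A B) <= count P (bracket_word A B).
Proof.
rewrite /unmatched; elim: (size _) => //= m; apply: leq_trans; exact: match_step_count.
Qed.

Lemma bracket_word_lower A B j : count_mem (true, j) (bracket_word A B) = A j.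
Proof.
rewrite /bracket_word count_flatten -map_comp sumnE big_map big_enum /=.
rewrite (bigD1 j) //= big1 => [|i ij]; rewrite count_cat !count_nseq /= !xpair_eqE /=.
  by rewrite eqxx /=; lia.
by rewrite (negbTE ij).
Qed.

Lemma bracket_word_upper A B j : count_mem (false, j) (bracket_word A B) = B j.
Proof.
rewrite /bracket_word count_flatten -map_comp sumnE big_map big_enum /=.
rewrite (bigD1 j) //= big1 => [|i ij]; rewrite count_cat !count_nseq /= !xpair_eqE /=.
  by rewrite eqxx /=; lia.
by rewrite (negbTE ij).
Qed.

Lemma sum_count_fiber (U : Type) (P : pred U) (f : U -> 'I_n) (s : seq U) :
  \sum_j count (fun a => P a && (f a == j)) s = count P s.
Proof.
elim: s => [|a s IH] /=; first by rewrite big1.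
rewrite big_split /= IH (bigD1 (f a)) //= eqxx andbT big1 ?addn0 // => j.
by rewrite eq_sym => /negbTE ->; rewrite andbF.
Qed.

Lemma size_multirow A : size A = \sum_j A j.
Proof.
rewrite -count_predT -(sum_count_fiber _ id); apply: eq_bigr => j _.
by rewrite -count_mem_mset.
Qed.

Lemma sum_count_mem_bracket o w : \sum_j count_mem (o, j) w = brackets o w.
Proof.
rewrite /brackets -(sum_count_fiber _ (fun a => a.2)).
by apply: eq_bigr => j _; apply: eq_count => -[b i]; rewrite /= xpair_eqE.
Qed.

Lemma brackets_lower A B : brackets true (bracket_word A B) = size A.
Proof.
rewrite -sum_count_mem_bracket size_multirow; apply: eq_bigr => j _.
exact: bracket_word_lower.
Qed.

Lemma brackets_upper A B : brackets false (bracket_word A B) = size B.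
Proof.
rewrite -sum_count_mem_bracket size_multirow; apply: eq_bigr => j _.
exact: bracket_word_upper.
Qed.

Lemma unpaired_lowerE A B j : unpaired_lower A B j = count_mem (true, j) (unmatched A B).
Proof.
rewrite mset_seqE count_map count_filter; apply: eq_count => -[b i] /=.
by rewrite xpair_eqE andbC eqb_id.
Qed.

Lemma unpaired_upperE A B j : unpaired_upper A B j = count_mem (false, j) (unmatched A B).
Proof.
rewrite mset_seqE count_map count_filter; apply: eq_count => -[b i] /=.
by rewrite xpair_eqE andbC eqbF_neg.
Qed.

Lemma unpaired_lower_le A B j : unpaired_lower A B j <= A j.
Proof. by rewrite unpaired_lowerE (leq_trans (unmatched_count _ _ _)) ?bracket_word_lower. Qed.

Lemma unmatched_all_upper A B : size A <= size B ->
  all (fun a => a.1 == false) (unmatched A B).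
Proof.
move=> le; have := unmatched_balance A B; rewrite brackets_lower brackets_upper.
have /orP[tr|fl _] := unmatched_uniform A B; last first.
  by apply: sub_all fl => -[[]].
have -> : brackets true (unmatched A B) = size (unmatched A B).
  by apply/eqP; rewrite -all_count; apply: sub_all tr => -[[]].
have -> : brackets false (unmatched A B) = 0.
  by apply/eqP; rewrite eqn0Ngt -has_count -all_predC; apply: sub_all tr => -[[]].
by move=> e; have /size0nil -> : size (unmatched A B) = 0 by lia.
Qed.

Lemma unmatched_all_lower A B : size B <= size A ->
  all (fun a => a.1 == true) (unmatched A B).
Proof.
move=> le; have := unmatched_balance A B; rewrite brackets_lower brackets_upper.
have /orP[tr _|fl] := unmatched_uniform A B.
  by apply: sub_all tr => -[[]].
have -> : brackets false (unmatched A B) = size (unmatched A B).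
  by apply/eqP; rewrite -all_count; apply: sub_all fl => -[[]].
have -> : brackets true (unmatched A B) = 0.
  by apply/eqP; rewrite eqn0Ngt -has_count -all_predC; apply: sub_all fl => -[[]].
by move=> e; have /size0nil -> : size (unmatched A B) = 0 by lia.
Qed.

Lemma unpaired_lower_eq0 A B j : size A <= size B -> unpaired_lower A B j = 0.
Proof.
move/unmatched_all_upper/allP => up; rewrite unpaired_lowerE.
by apply/count_memPn/negP => /up.
Qed.

Lemma unpaired_upper_eq0 A B j : size B <= size A -> unpaired_upper A B j = 0.
Proof.
move/unmatched_all_lower/allP => lo; rewrite unpaired_upperE.
by apply/count_memPn/negP => /lo.
Qed.

(** When the lower row is not the larger one, only upper particles remain
    unpaired, so every stationary value of the original word computes them. *)
Lemma unpaired_upper_surplus A B d : size A <= size B ->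
  circular_surplus true (oriented true (bracket_word A B)) d ->
  d =1 unpaired_upper A B.
Proof.
move=> le /unmatched_surplus cd j; rewrite unpaired_upperE.
apply: (circular_surplus_end (o := true) _ cd); exact: unmatched_all_upper.
Qed.

Lemma unpaired_lower_surplus A B d : size B <= size A ->
  circular_surplus false (oriented false (bracket_word A B)) d ->
  d =1 unpaired_lower A B.
Proof.
move=> le /unmatched_surplus cd j; rewrite unpaired_lowerE -count_rev.
by apply: (circular_surplus_end (o := false) _ cd); rewrite all_rev unmatched_all_lower.
Qed.

(** The added upper particles are closing brackets when read forwards and
    opening ones when read backwards, whence the exchange of the two words. *)
Lemma bracket_word_dominated A B B' : (forall j, B j <= B' j) ->
  dominated true (bracket_word A B) (bracket_word A B') /\
  dominated false (rev (bracket_word A B')) (rev (bracket_word A B)).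
Proof.
move=> le; rewrite /bracket_word; elim: (enum _) => [|j s [IHt IHf]] /=.
  by split; apply: dominated_refl.
have -> : nseq (B' j) (false, j) = nseq (B j) (false, j) ++ nseq (B' j - B j) (false, j).
  by rewrite -nseqD subnKC.
split.
  apply: dominated_cat IHt; apply: dominated_cat (dominated_refl _ _).
  rewrite -{1}[nseq (B j) _]cats0.
  exact: dominated_cat (dominated_refl _ _) (dominated_closers _ _ _).
rewrite !rev_cat; apply: dominated_cat IHf _; apply: dominated_cat (dominated_refl _ _) _.
rewrite -{2}[rev (nseq (B j) _)]cat0s !rev_nseq.
by apply: dominated_cat (dominated_openers _ _ _) (dominated_refl _ _).
Qed.

(** If the lower row is larger than [B], then [B] has no unpaired particle, and
    otherwise both surpluses are computed by the counter. *)
Lemma unpaired_upper_mono A B B' : (forall j, B j <= B' j) ->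
  forall j, unpaired_upper A B j <= unpaired_upper A B' j.
Proof.
move=> leB j; have sBB' : size B <= size B' by rewrite !size_multirow leq_sum.
have [le|/ltnW gt] := leqP (size A) (size B); last by rewrite unpaired_upper_eq0.
have [dom _] := bracket_word_dominated A leB.
apply: dominated_surplus dom _ _ _ j => [d|d|].
- exact: unpaired_upper_surplus.
- exact/unpaired_upper_surplus/(leq_trans le).
- by rewrite brackets_lower brackets_upper.
Qed.

Lemma unpaired_lower_anti A B B' : (forall j, B j <= B' j) ->
  forall j, unpaired_lower A B' j <= unpaired_lower A B j.
Proof.
move=> leB j; have sBB' : size B <= size B' by rewrite !size_multirow leq_sum.
have [le|/ltnW gt] := leqP (size B') (size A); last by rewrite unpaired_lower_eq0.
have [_ dom] := bracket_word_dominated A leB.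
apply: dominated_surplus dom _ _ _ j => [d|d|].
- exact: unpaired_lower_surplus.
- exact/unpaired_lower_surplus/(leq_trans sBB').
- by rewrite /brackets !count_rev -!/(brackets _ _) brackets_lower brackets_upper.
Qed.

End Matching.

(** * Telescoping sums and seeded extrema *)

Lemma count_big_msetn (P : pred nat) (f g : nat -> nat) p q :
  count P (\big[msetD/mset0]_(p <= r < q) msetn (f r) (g r)) =
  \sum_(p <= r < q) P (g r) * f r.
Proof.
rewrite (big_morph (fun A : {mset nat} => count P A) (id1 := 0) (op1 := addn) (count_msetD P)).
  by apply: eq_bigr => r _; rewrite enum_msetn count_nseq.
by rewrite enum_mset0.
Qed.

(** When no index of the range reaches [m], monotonicity makes the truncated
    difference vanish, in agreement with the zero sum. *)
Lemma telescope_tail (f : nat -> nat) m p q : (forall x y, x <= y -> f y <= f x) ->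
  \sum_(p <= r < q) (m <= r) * (f r - f r.+1) = f (maxn m p) - f q.
Proof.
move=> anti; elim: q => [|q IH].
  by rewrite big_geq //; have := anti 0 (maxn m p) (leq0n _); lia.
have [le|lt] := leqP p q; last first.
  rewrite big_geq //; have : f (maxn m p) <= f q.+1 by apply: anti; lia.
  by lia.
rewrite big_nat_recr //= IH.
have [lem|ltm] := leqP m q.
  have : f q <= f (maxn m p) by apply: anti; lia.
  have : f q.+1 <= f q by apply: anti.
  by lia.
have h1 : f (maxn m p) <= f q.+1 by apply: anti; lia.
have h2 : f q.+1 <= f q by apply: anti.
lia.
Qed.

Lemma bigmaxn_seed (a : nat) (P : pred nat) (s : seq nat) :
  let m := \big[maxn/a]_(r <- s | P r) r in
  [/\ a <= m, forall r, r \in s -> P r -> r <= m & m = a \/ m \in s /\ P m].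
Proof.
elim: s => [|x s [IHa IHle IHex]] /=; first by rewrite big_nil; split=> //; left.
rewrite big_cons; set m := bigop _ _ _ in IHa IHle IHex *.
case: ifP => Px; last first.
  split=> // [r|]; first by rewrite inE => /orP[/eqP->|/IHle//]; rewrite Px.
  by case: IHex => [->|[ms Pm]]; [left | right; rewrite inE ms orbT].
split=> [|r|]; first by lia.
  by rewrite inE => /orP[/eqP-> _|/IHle H /H]; lia.
case: (leqP m x) => le.
  by right; rewrite inE eqxx.
by case: IHex => [->|[ms Pm]]; [left | right; rewrite inE ms orbT].
Qed.

Lemma bigminn_le (I : eqType) (s : seq I) (F : I -> nat) K i :
  i \in s -> \big[minn/K]_(x <- s) F x <= F i.
Proof.
elim: s => //= x s IH; rewrite inE big_cons geq_min => /orP[/eqP->|/IH ->].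
  by rewrite leqnn.
by rewrite orbT.
Qed.

Lemma bigminn_ge (I : eqType) (s : seq I) (F : I -> nat) K l :
  l <= K -> (forall i, i \in s -> l <= F i) -> l <= \big[minn/K]_(x <- s) F x.
Proof.
move=> lK lF; rewrite big_seq_cond; apply: (big_ind (leq l)) => // [x y ? ?|i].
  by rewrite leq_min; apply/andP.
by rewrite andbT; apply: lF.
Qed.

(** * Levels of the word produced by an operator *)

Section Levels.
Variable n : nat.
Implicit Types (A B D : multirow n) (u : word n).

Definition R_first (b c : multirow n) : multirow n := (comb_R (b, c)).1.

Lemma R_firstE b c j :
  R_first b c j = b j - unpaired_lower b c j + unpaired_upper b c j.
Proof. by rewrite /R_first /comb_R /= msetE2 /paired_lower msetE2. Qed.

Lemma levelE u r j : level u r j = count (leq r) (u j).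
Proof.
rewrite /level mset_seqE count_flatten -map_comp sumnE big_map big_enum /=.
rewrite (bigD1 j) //= big1 => [|i ij]; rewrite count_nseq /= ?eqxx; first by lia.
by rewrite (negbTE ij).
Qed.

Lemma level_anti u r r' j : r <= r' -> level u r' j <= level u r j.
Proof. by move=> le; rewrite !levelE; apply: sub_count => x /=; apply: leq_trans. Qed.

Lemma size_level_anti u r r' : r <= r' -> size (level u r') <= size (level u r).
Proof.
by move=> le; rewrite !size_multirow; apply: leq_sum => j _; apply: level_anti.
Qed.

Lemma le_max_word u j x : x \in u j -> x <= max_word u.
Proof.
move=> xu; apply: (@leq_trans (\max_(y <- u j) y)).
  exact: (leq_bigmax_seq (F := id) _ xu).
exact: (leq_bigmax (F := fun j : 'I_n => \max_(y <- u j) y) j).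
Qed.

Lemma ge_min_word u j x : x \in u j -> min_word u <= x.
Proof.
move=> xu; rewrite /min_word.
apply: leq_trans (bigminn_le (i := j) _ _ _) _; first by rewrite mem_index_enum.
exact: (bigminn_le id).
Qed.

Lemma min_word_le_max u : min_word u <= max_word u.
Proof.
rewrite /min_word; apply: (big_rec (fun x => x <= max_word u)) => // j x _ le.
by rewrite geq_min le orbT.
Qed.

Lemma min_word_gt u l : u != empty_word n ->
  (forall j, all (leq l.+1) (u j)) -> l < min_word u.
Proof.
move=> une lu.
have lK : l < max_word u.
  suff /existsP[j] : [exists j, u j != mset0].
    case E: (enum_mset (u j)) => [|x s].
      case/eqP; apply/msetP => x; rewrite mset0E; apply/mset_eq0P.
      by rewrite (_ : (x \in u j) = (x \in enum_mset (u j))) // E.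
    move=> _; have xu : x \in u j.
      by rewrite (_ : (x \in u j) = (x \in enum_mset (u j))) // E mem_head.
    by apply: leq_trans (le_max_word xu); apply: (allP (lu j)).
  apply: contraNT une; rewrite negb_exists => /forallP H; apply/eqP/ffunP => j.
  by rewrite ffunE; apply/eqP; rewrite -[_ == _]negbK H.
by rewrite /min_word; apply: bigminn_ge => // j _; apply: bigminn_ge => // x /(allP (lu j)).
Qed.

(** The levels below the smallest entry all coincide, which makes the lower
    cut-off of the collapsing phase invisible. *)
Lemma level_low u r : r <= min_word u -> level u r = level u (min_word u).
Proof.
move=> le; apply/msetP => j; rewrite !levelE; apply: eq_in_count => x xu.
by rewrite (ge_min_word xu) (leq_trans le (ge_min_word xu)).
Qed.

Lemma level_high u r : max_word u < r -> level u r = mset0.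
Proof.
move=> lt; apply/msetP => j; rewrite levelE mset0E; apply/eqP.
rewrite eqn0Ngt -has_count -all_predC; apply/allP => x xu /=.
by rewrite -ltnNge (leq_ltn_trans (le_max_word xu)).
Qed.

Lemma size_mset0 : size (mset0 : multirow n) = 0.
Proof. by rewrite enum_mset0. Qed.

Lemma paired_lower_mono D B B' j : (forall i, B i <= B' i) ->
  paired_lower D B j <= paired_lower D B' j.
Proof.
by move=> le; rewrite /paired_lower !msetE2 leq_sub2l // unpaired_lower_anti.
Qed.

(** The unpaired particles of [D] form a part of [D], and by the balance of
    brackets they have the size of [D]. *)
Lemma unpaired_lower_mset0 D : unpaired_lower D mset0 = D.
Proof.
have sz : size (unpaired_lower D mset0) = size D.
  have := unmatched_balance D mset0; rewrite brackets_lower brackets_upper size_mset0.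
  rewrite -2!sum_count_mem_bracket size_multirow.
  under eq_bigr => j _ do rewrite -unpaired_lowerE.
  rewrite -size_multirow.
  under eq_bigr => j _ do rewrite -unpaired_upperE.
  by rewrite big1 => [|j _]; [lia | rewrite unpaired_upper_eq0 // size_mset0].
apply/msetP => j; have le (i : 'I_n) := unpaired_lower_le D mset0 i.
have leS : \sum_(i < n | i != j) unpaired_lower D mset0 i <= \sum_(i < n | i != j) D i.
  by apply: leq_sum => i _; apply: le.
apply/eqP; rewrite eqn_leq le -(leq_add2r (\sum_(i < n | i != j) D i)).
have := sz; rewrite !size_multirow !(bigD1 (P := xpredT) j) //= => <-.
by rewrite leq_add2l.
Qed.

Lemma R_first_mset0 D : R_first D mset0 = mset0.
Proof.
apply/msetP => j; rewrite R_firstE unpaired_lower_mset0 mset0E subnn.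
by rewrite unpaired_upper_eq0 // size_mset0.
Qed.

Lemma last_paired_levelP D u (s := last_paired_level D u) :
  [/\ min_word u <= s,
      forall r, s < r -> size (level u r) <= size D &
      s = min_word u \/ s <= max_word u /\ size D <= size (level u s)].
Proof.
rewrite {}/s /last_paired_level /index_iota.
set I := iota _ _; have := bigmaxn_seed (min_word u) (fun r => size D <= size (level u r)) I.
set s := bigop _ _ _ => -[as_ sP sex]; split=> // [r lt|].
  have [le|gt] := leqP r (max_word u); last by rewrite level_high // size_mset0.
  rewrite leqNgt; apply/negP => /ltnW szr.
  have rI : r \in I by rewrite mem_iota; lia.
  by have := sP r rI szr; rewrite leqNgt lt.
case: sex => [|[]]; first by left.
by rewrite mem_iota => sI szs; right; split=> //; lia.
Qed.

(** The three terms are the pairing phase, the unpaired particles of [D], and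
    the collapsing phase, each summed from [m] upwards.  The sums end with
    zero: nothing is paired with the empty level above the maximum, and nothing
    of level [s.+1] is unpaired. *)
Lemma count_mlq_op l D u m j (s := last_paired_level D u) :
    0 < l -> u != empty_word n -> (forall j, all (leq l.+1) (u j)) ->
  count (leq m) (mlq_op l D u j) =
  paired_lower D (level u (maxn m s)) j
  + (m <= l) * unpaired_lower D (level u s) j
  + unpaired_upper D (level u m.+1) j.
Proof.
move=> l_gt0 une lu; rewrite /mlq_op (negbTE une) ffunE -/s.
have [as_ sgt _] := last_paired_levelP D u; rewrite -/s in as_ sgt.
have al := min_word_gt une lu.
rewrite !count_msetD !count_big_msetn enum_msetn count_nseq /newly_paired /newly_unpaired.
congr (_ + _ + _).
  rewrite (telescope_tail (f := fun r => paired_lower D (level u r) j)); last first.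
    by move=> x y le; apply: paired_lower_mono => i; apply: level_anti.
  rewrite [level u (max_word u).+1]level_high // /paired_lower msetE2.
  by rewrite msetE2 unpaired_lower_mset0 subnn subn0.
under eq_big_nat => r rP.
  have -> : (m <= r.-1) = (m.+1 <= r) by lia.
  over.
rewrite (telescope_tail (f := fun r => unpaired_upper D (level u r) j)); last first.
  by move=> x y le; apply: unpaired_upper_mono => i; apply: level_anti.
rewrite [X in _ - X]unpaired_upper_eq0 ?sgt // subn0.
have [le|lt] := leqP (min_word u) m.+1; first by [].
by rewrite (level_low (ltnW lt)).
Qed.

(** The position of [D] among the levels is the last paired level when that
    level covers [D], and otherwise the new label [l], as then [D] contains every
    F(D, u^(r)).  The same dichotomy decides which of the two parts of
    F(D, u^(r)) is trivial.  The upper bound on [s] keeps the insertion within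
    the levels of [u]. *)
Lemma mlq_op_levels l D u : 0 < l -> (forall j, all (leq l.+1) (u j)) ->
  exists s, [/\ l <= s, s <= maxn l (max_word u) &
    forall m j, l <= m -> count (leq m) (mlq_op l D u j) =
      if m < s then R_first D (level u m.+1) j
      else if m == s then D j else R_first D (level u m) j].
Proof.
move=> l_gt0 lu; have [->|une] := eqVneq u (empty_word n).
  exists l; split=> // [|m j lem]; first by lia.
  rewrite /mlq_op eqxx ffunE enum_msetn count_nseq ltnNge lem /=.
  have [->|ne] := eqVneq m l; first by rewrite leqnn mul1n.
  rewrite level_high ?R_first_mset0 ?mset0E; first by rewrite leqNgt ltn_neqAle eq_sym ne lem.
  rewrite /max_word big1 => [|i _]; first exact: leq_trans lem.
  by rewrite ffunE enum_mset0 big_nil.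
have [as_ sgt sP] := last_paired_levelP D u; set s := last_paired_level D u in as_ sgt sP.
have al := min_word_gt une lu.
(* If [D] is larger than the last paired level, all of its particles are
   counted from [l] on, those unpaired at that level having label [l]. *)
exists (if size D <= size (level u s) then s else l); split.
- by case: ifP => // _; lia.
- case: ifP => [_|_]; last by lia.
  by have := min_word_le_max u; case: sP => [|[]]; lia.
move=> m j lem; rewrite count_mlq_op // -/s !R_firstE /paired_lower !msetE2.
have up0 r : s < r -> unpaired_upper D (level u r) j = 0.
  by move=> lt; apply/unpaired_upper_eq0/sgt.
case: (leqP (size D) (size (level u s))) => szD.
  have lo0 r : r <= s -> unpaired_lower D (level u r) j = 0.
    by move=> le; apply/unpaired_lower_eq0/(leq_trans szD)/size_level_anti.
  rewrite (lo0 s) // muln0 addn0; case: ltngtP => [lt|gt|->].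
  - by rewrite !lo0.
  - by rewrite !up0 //; lia.
  - by rewrite lo0 // up0 // subn0 addn0.
have sE : s = min_word u by case: sP => // -[_ H]; move: szD; rewrite ltnNge H.
have up0' r : unpaired_upper D (level u r) j = 0.
  have [le|/up0//] := leqP r s; rewrite unpaired_upper_eq0 //.
  by rewrite sE in le; rewrite (level_low le) -sE ltnW.
rewrite !up0' !addn0; case: ltngtP lem => // [lt _|-> _].
  have -> : level u (maxn m s) = level u m; last by lia.
  have [le|lt'] := leqP m s; last by [].
  by rewrite sE in le *; rewrite [RHS]level_low.
rewrite (maxn_idPr _); last by lia.
by have := unpaired_lower_le D (level u s) j; lia.
Qed.

Lemma mlq_op_ge l D u : 0 < l -> (forall j, all (leq l.+1) (u j)) ->
  forall j, all (leq l) (mlq_op l D u j).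
Proof.
move=> l_gt0 lu j; have [->|une] := eqVneq u (empty_word n).
  by rewrite /mlq_op eqxx ffunE enum_msetn all_nseq leqnn orbT.
have [as_ _ _] := last_paired_levelP D u; have al := min_word_gt une lu.
rewrite all_count -[size _](count_predT) (@eq_count _ predT (leq 0)) //.
rewrite !count_mlq_op // !leq0n leqnn /=; apply/eqP; congr (_ + _ + _).
  by congr (paired_lower _ (level _ _) _); lia.
by rewrite !(@level_low u) //; lia.
Qed.

End Levels.

(** * The projection of the crystal element *)

Section Projection.
Variable n : nat.
Implicit Types (x : multirow n) (b Q : seq (multirow n)) (u : word n).

Definition pi_factors b := [seq pi_factor b i | i <- iota 1 (size b)].

(** An R matrix away from the first factor does not see it; this is the shift
    behind the recursion for the factors. *)
Lemma R_at_cons i x b : R_at i.+2 (x :: b) = x :: R_at i.+1 b.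
Proof. by rewrite /R_at. Qed.

(** The last R matrix applied is the one at the first two factors, and the
    others have by then brought the corresponding factor of [b] next to [x]. *)
Lemma pi_factor_cons x b i :
  pi_factor (x :: b) i.+2 = R_first x (pi_factor b i.+1).
Proof.
have E : foldr (@R_at n) (x :: b) (iota 2 i) = x :: foldr (@R_at n) b (iota 1 i).
  rewrite [in iota 2 i](iotaDl 1 1) foldr_map.
  have : all (leq 1) (iota 1 i) by apply/allP => k; rewrite mem_iota => /andP[].
  by elim: (iota 1 i) => //= -[|k] s IH //= /IH ->; rewrite R_at_cons.
by rewrite /pi_factor /R_range /index_iota !subn1 /= E.
Qed.

Lemma pi_factors_cons x b :
  pi_factors (x :: b) = x :: [seq R_first x c | c <- pi_factors b].
Proof.
rewrite /pi_factors /= (iotaDl 1 1) -!map_comp; congr (_ :: _).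
by apply/eq_in_map => -[|i]; rewrite mem_iota //= => _; rewrite pi_factor_cons.
Qed.

(** The recursion on rows behind the indexed fold, started at label [l], which
    is the form that the induction needs. *)
Fixpoint queue_word l b : word n :=
  if b is x :: b' then mlq_op l x (queue_word l.+1 b') else empty_word n.

Lemma Phi_queue_word b : Phi b = queue_word 1 b.
Proof.
suff E r m : size b = m + r -> foldr (fun i w => mlq_op i (nth mset0 b i.-1) w)
    (empty_word n) (iota m.+1 r) = queue_word m.+1 (drop m b).
  by rewrite /Phi (E _ 0) // drop0.
elim: r m => [|r IH] m szb /=; first by rewrite drop_oversize ?szb ?addn0.
by rewrite IH ?szb ?addnS // [in RHS](drop_nth mset0) // szb; lia.
Qed.

Lemma nth_map_R_first x b i :
  nth mset0 [seq R_first x c | c <- b] i = R_first x (nth mset0 b i).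
Proof.
have [lt|ge] := ltnP i (size b); first exact: nth_map.
by rewrite !nth_default ?size_map // R_first_mset0.
Qed.

(** The bound on the entries is part of the induction since the operator of
    label [l] describes its output only on words with entries above [l]. *)
Lemma queue_word_levels l b : 0 < l ->
  (forall j, all (leq l) (queue_word l b j)) /\
  exists2 Q, perm_eq Q (pi_factors b) &
    forall m j, count (leq (l + m)) (queue_word l b j) = nth mset0 Q m j.
Proof.
elim: b l => [|x b IH] l l_gt0 /=.
  split=> [j|]; first by rewrite ffunE enum_mset0.
  by exists [::] => // m j; rewrite ffunE enum_mset0 nth_nil mset0E.
have [//|lu [Q permQ QP]] := IH l.+1.
split; first exact: mlq_op_ge.
have levelQ m : level (queue_word l.+1 b) (l + m).+1 = nth mset0 Q m.
  by apply/msetP => j; rewrite levelE QP.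
(* [Q] lists all the nonempty levels, so no entry exceeds [l + size Q]. *)
have maxQ : max_word (queue_word l.+1 b) <= l + size Q.
  apply/bigmax_leqP => j _; apply/bigmax_leqP_seq => y yu _.
  rewrite leqNgt; apply/negP => lt.
  have : count (leq (l + size Q).+1) (queue_word l.+1 b j) = 0.
    by rewrite QP nth_default ?mset0E.
  by move/eqP; rewrite eqn0Ngt -has_count; case/hasP; exists y.
have [s [les lesK sP]] := mlq_op_levels x l_gt0 lu.
have sz : size (take (s - l) Q) = s - l by rewrite size_take; case: ltnP; lia.
(* [x] has level [s], hence [s - l] elements precede it. *)
exists (map (R_first x) (take (s - l) Q) ++ x :: map (R_first x) (drop (s - l) Q)).
  rewrite pi_factors_cons -cat1s perm_catCA /= perm_cons -map_cat cat_take_drop.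
  exact: perm_map.
move=> m j; rewrite sP ?leq_addr // nth_cat size_map sz.
have -> : (l + m < s) = (m < s - l) by lia.
case: ltnP => [lt|ge]; first by rewrite nth_map_R_first nth_take // levelQ.
case: eqP => [e|ne]; first by have -> : m - (s - l) = 0 by lia.
have -> : m - (s - l) = (m - (s - l)).-1.+1 by lia.
rewrite /= nth_map_R_first nth_drop.
have -> : s - l + (m - (s - l)).-1 = m.-1 by lia.
by rewrite -levelQ; congr (R_first x (level _ _) j); lia.
Qed.

Lemma mset_eq_count (A B : {mset nat}) :
  (forall m, count (leq m) A = count (leq m) B) -> A = B.
Proof.
move=> AB; apply/msetP => x; apply/(@addnI (count (leq x.+1) A)).
rewrite {2}AB -!count_mem_mset.
suff E (C : {mset nat}) : count (leq x.+1) C + count_mem x C = count (leq x) C.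
  by rewrite !E.
rewrite -count_predUI [X in _ + X](@eq_count _ _ pred0) ?count_pred0 ?addn0.
  by apply: eq_count => y /=; rewrite [x <= y]leq_eqVlt orbC eq_sym.
by move=> y /=; case: eqP => [->|]; rewrite ?ltnn ?andbF.
Qed.

(** A list whose values at site [j] decrease is its own sorted version there, so
    it computes the sorted multiplicities of any permutation of it. *)
Lemma mth_largest_nth b Q j m : perm_eq Q b ->
  (forall i, nth mset0 Q i.+1 j <= nth mset0 Q i j) ->
  mth_largest m.+1 [seq c j | c : multirow n <- b] = nth mset0 Q m j.
Proof.
move=> permQ anti; rewrite /mth_largest /=.
have nthQ i : nth 0 [seq c j | c : multirow n <- Q] i = nth mset0 Q i j.
  have [lt|ge] := ltnP i (size Q); first by rewrite (nth_map mset0).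
  by rewrite !nth_default ?size_map // mset0E.
have geq_trans : transitive geq by move=> y x z /= xy yz; apply: leq_trans yz xy.
have geq_total : total geq by move=> x y; apply: leq_total.
have geq_anti : antisymmetric geq.
  by move=> x y /andP[xy yx]; apply/eqP; rewrite eqn_leq; apply/andP; split.
rewrite -nthQ; congr (nth 0 _ m).
have /(perm_sortP geq_total geq_trans geq_anti) <- :
    perm_eq [seq c j | c : multirow n <- Q] [seq c j | c : multirow n <- b].
  exact: perm_map.
rewrite sorted_sort //; apply/(sortedP 0) => i _.
by rewrite !nthQ; apply: anti.
Qed.

End Projection.

Theorem theorem4p16 (n k : nat) (hn : 0 < n)
    (alpha : k.-tuple nat) (D : k.-tuple (multirow n)) (hD : is_bmlq alpha D) :
  Phi D = proj_pi D.
Proof.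
rewrite Phi_queue_word; have [ge1 [Q permQ QP]] := @queue_word_levels n 1 D isT.
apply/ffunP => j; rewrite ffunE; apply: mset_eq_count.
have E1 m : count (leq m.+1) (queue_word 1 D j) =
    count (leq m.+1) (letter_of [seq c j | c : multirow n <- pi_factors D]).
  rewrite count_letter_of // -[m.+1]add1n QP add1n (mth_largest_nth _ permQ) // => i.
  by rewrite -!QP; apply: sub_count => x /=; apply: leq_trans; rewrite leq_add2l.
case=> [|m]; last exact: E1.
(* All entries are positive, so counting from 0 or from 1 is the same. *)
rewrite [LHS](_ : _ = count (leq 1) (queue_word 1 D j)); last first.
  by apply: eq_in_count => x /(allP (ge1 j)).
rewrite E1 /letter_of !count_big_msetn; apply: eq_big_nat => r /andP[r_gt0 _].
by rewrite r_gt0.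
Qed.
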